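(* Let $k,\ell$ be positive integers. Then $$\mathcal{D}(P_k\,\square\,P_\ell,\mathcal{P})>\frac{k\ell}{8}-\frac{\max\{k,\ell\}}{8}-\min\{k,\ell\}.$$ That is, for every labeling $f$ of the edges of $P_k\,\square\,P_\ell$ by $\{-1,1\}$ there is a path $Q$ in $P_k\,\square\,P_\ell$ with $\left|\sum_{e\in E(Q)}f(e)\right|>k\ell/8-\max\{k,\ell\}/8-\min\{k,\ell\}$.
   Context: $P_k$ is the path on $k$ vertices and $\square$ is the Cartesian product of graphs, so $P_k\,\square\,P_\ell$ is the $k\times\ell$ grid graph. For a graph $G$, a family $\mathcal{S}_G$ of subgraphs of $G$ and $f:E(G)\to\{-1,1\}$, put $f(S)=\sum_{e\in E(S)}f(e)$ for $S\in\mathcal{S}_G$; the discrepancy is $\mathcal{D}(G,\mathcal{S}_G)=\min_f\max_{S\in\mathcal{S}_G}|f(S)|$, the minimum being over all $f:E(G)\to\{-1,1\}$. $\mathcal{P}$ is the set of all (not necessarily spanning) paths that are subgraphs of $G$; a single vertex counts as a path. *)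

(* Defs.v *)
From mathcomp Require Import all_boot all_order all_algebra.

Set Implicit Arguments.
Unset Strict Implicit.
Unset Printing Implicit Defensive.

Import Order.TTheory GRing.Theory Num.Theory.

Record sgraph := SGraph {
  vertex :> finType;
  adj : rel vertex;
  adj_sym : symmetric adj;
  adj_irr : irreflexive adj }.

Definition path_adj k : rel 'I_k := [rel i j : 'I_k | (i.+1 == j) || (j.+1 == i)].

Lemma path_adj_sym k : symmetric (@path_adj k).
Proof. by move=> i j; rewrite /path_adj /= orbC. Qed.

Lemma path_adj_irr k : irreflexive (@path_adj k).
Proof. by move=> i; rewrite /path_adj /= orbb; apply/negbTE; rewrite neq_ltn ltnSn orbT. Qed.

Definition path_graph k : sgraph :=
  SGraph (@path_adj_sym k) (@path_adj_irr k).

Definition cart_adj (G H : sgraph) : rel (G * H)%type :=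
  [rel x y | (x.1 == y.1) && adj x.2 y.2 || adj x.1 y.1 && (x.2 == y.2)].

Lemma cart_adj_sym G H : symmetric (@cart_adj G H).
Proof.
by move=> x y; rewrite /cart_adj /= (eq_sym x.1) (eq_sym x.2) (adj_sym x.1) (adj_sym x.2).
Qed.

Lemma cart_adj_irr G H : irreflexive (@cart_adj G H).
Proof. by move=> x; rewrite /cart_adj /= !adj_irr andbF. Qed.

Definition cart_prod (G H : sgraph) : sgraph :=
  SGraph (@cart_adj_sym G H) (@cart_adj_irr G H).

Definition is_edge (G : sgraph) (e : {set G}) : bool :=
  [exists x : G, exists y : G, adj x y && (e == [set x; y])].

Definition edge (G : sgraph) := {e : {set G} | is_edge e}.

Definition is_subgraph (G : sgraph) (H : {set G} * {set edge G}) : bool :=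
  [forall e in H.2, val e \subset H.1].

Definition subgraph (G : sgraph) :=
  {H : {set G} * {set edge G} | is_subgraph H}.

Definition vertices (G : sgraph) (S : subgraph G) : {set G} := (val S).1.
Definition edges (G : sgraph) (S : subgraph G) : {set edge G} := (val S).2.

Definition traces (G : sgraph) (S : subgraph G) (s : seq G) : bool :=
  [&& uniq s, sorted (@adj G) s, vertices S == [set x in s]
    & edges S == [set e | val e \in [seq [set q.1; q.2] | q <- zip s (behead s)]]].

(* A path has between 1 and #|G| vertices; n counts its edges. *)
Definition is_path (G : sgraph) (S : subgraph G) : bool :=
  [exists n : 'I_#|G|, exists t : n.+1.-tuple G, traces S t].

Definition paths (G : sgraph) : {set subgraph G} := [set S | is_path S].

Definition sign := seq_sub [:: -1; 1 : int]%R.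

Definition labeling (G : sgraph) := {ffun edge G -> sign}.

Definition label_sum (G : sgraph) (f : labeling G) (S : subgraph G) : int :=
  (\sum_(e in edges S) val (f e))%R.

(* The maximum over an empty family is 0. *)
Definition max_abs (G : sgraph) (F : {set subgraph G}) (f : labeling G) : nat :=
  \max_(S in F) `|label_sum f S|%N.

Definition sign1 : sign := SeqSub (mem_last (-1)%R [:: 1 : int]%R).

(* The constant labeling only witnesses that the set of labelings
   over which the minimum is taken is nonempty. *)
Definition discrepancy (G : sgraph) (F : {set subgraph G}) : nat :=
  max_abs F [arg min_(f < [ffun=> sign1] : labeling G) max_abs F f].

(* Main.v *)
(** Cut the grid into [min(k, l) / 2] ladders, each made of two consecutive
    long lines, and traverse them one after the other in a snake.  Inside a
    ladder, propagate along the columns two pairs of paths, [(A0, A1)] and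
    [(B0, B1)], the index being the side on which a path currently stands.  At
    every rung either both members of the A-pair cross it (label 1) or both
    members of the B-pair do (label -1); the rails contribute the same amount to
    both pairs, so each rung increases [f A0 + f A1 - f B0 - f B1] by 2.
    Hence the two ends of a ladder are joined by two paths whose sums differ by
    almost its length.  Concatenating over the ladders yields two paths whose
    sums differ by about [k l / 2], and one of them has a sum of at least half
    that size in absolute value. *)

Require Import Defs.
From mathcomp Require Import all_boot all_order all_algebra.
From mathcomp Require Import zify lra.

Import Order.TTheory GRing.Theory Num.Theory.

Local Open Scope ring_scope.

(** * Signed sums along vertex sequences *)

Fixpoint path_sum {T : Type} (g : T -> T -> int) (x : T) (s : seq T) : int :=
  if s is y :: s' then g x y + path_sum g y s' else 0.

Lemma path_sum_cat {T : Type} (g : T -> T -> int) x s1 s2 :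
  path_sum g x (s1 ++ s2) = path_sum g x s1 + path_sum g (last x s1) s2.
Proof. by elim: s1 x => [|y s1 IH] x /=; [rewrite add0r | rewrite IH addrA]. Qed.

Lemma path_sum_rcons {T : Type} (g : T -> T -> int) x s y :
  path_sum g x (rcons s y) = path_sum g x s + g (last x s) y.
Proof. by rewrite -cats1 path_sum_cat /= addr0. Qed.

(** The default 0 off the edges makes the labeling total on vertex sets, so sums along sequences
    carry no adjacency proofs. *)
Definition edge_label {G : sgraph} (f : labeling G) (E : {set G}) : int :=
  oapp (fun e => val (f e)) 0 (insub E).

Definition step_sets {T : finType} (s : seq T) : seq {set T} :=
  [seq [set q.1; q.2] | q <- zip s (behead s)].

Lemma step_sets_sub {T : finType} (s : seq T) E y :
  E \in step_sets s -> y \in E -> y \in s.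
Proof.
elim: s => [//|x [//|z s] IH]; rewrite [step_sets _]/= inE => /orP[/eqP->|].
  by rewrite !inE => /orP[]->; rewrite ?orbT.
by move=> Es yE; rewrite inE (IH Es yE) orbT.
Qed.

(** The head of the sequence lies in the first step, whereas all later steps are contained in the
    tail. *)
Lemma step_sets_uniq {T : finType} (s : seq T) : uniq s -> uniq (step_sets s).
Proof.
elim: s => [//|x [//|y s] IH] /andP[xs ys].
rewrite [step_sets _]/= cons_uniq (IH ys) andbT.
by apply: contra xs => /step_sets_sub; apply; rewrite !inE eqxx.
Qed.

Lemma step_sets_edge {G : sgraph} (x : G) s E :
  path (@adj G) x s -> E \in step_sets (x :: s) -> is_edge E.
Proof.
elim: s x => [//|y s IH] x /andP[xy ys].
rewrite [step_sets _]/= inE => /orP[/eqP->|]; last exact: IH.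
by apply/existsP; exists x; apply/existsP; exists y; rewrite xy eqxx.
Qed.

Lemma path_sum_step_sets {G : sgraph} (f : labeling G) x s :
  path_sum (fun y z => edge_label f [set y; z]) x s
  = \sum_(E <- step_sets (x :: s)) edge_label f E.
Proof.
elim: s x => [|y s IH] x; first by rewrite big_nil.
by rewrite [step_sets _]/= big_cons -IH.
Qed.

Lemma path_sum_label_sum {G : sgraph} (f : labeling G) x s :
    path (@adj G) x s -> uniq (x :: s) ->
  exists2 S, S \in paths G &
    label_sum f S = path_sum (fun y z => edge_label f [set y; z]) x s.
Proof.
move=> xs Us.
pose H := ([set y in x :: s], [set e : edge G | val e \in step_sets (x :: s)]).
have HP : is_subgraph H.
  apply/forallP=> e; apply/implyP; rewrite inE => es.
  by apply/subsetP=> y ye; rewrite inE (step_sets_sub _ _ _ es ye).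
exists (exist _ H HP).
  rewrite inE; apply/existsP.
  have sG : (size s < #|G|)%N by rewrite -[(size s).+1]/(size (x :: s)) -(card_uniqP Us) max_card.
  exists (Ordinal sG); apply/existsP.
  by exists (in_tuple (x :: s)); rewrite /traces Us /= xs !eqxx.
rewrite path_sum_step_sets /label_sum /edges /=.
transitivity (\sum_(e <- pmap insub (step_sets (x :: s)) : seq (edge G)) val (f e)).
  rewrite big_uniq ?pmap_sub_uniq ?step_sets_uniq //.
  by apply: eq_bigl => e; rewrite inE mem_pmap_sub.
by rewrite big_pmap.
Qed.

(** The witness is the minimizing labeling itself. *)
Lemma discrepancy_paths_ge (G : sgraph) :
  exists f : labeling G, forall x s, path (@adj G) x s -> uniq (x :: s) ->
    (`|path_sum (fun y z => edge_label f [set y; z]) x s|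
       <= discrepancy (paths G))%N.
Proof.
rewrite /discrepancy; set f := (X in max_abs _ X); exists f => x s xs Us.
have [S Sp <-] := path_sum_label_sum f x s xs Us.
by rewrite /max_abs (bigD1 S Sp) /= leq_maxl.
Qed.

Lemma edge_label_sign {G : sgraph} (f : labeling G) (x y : G) :
  adj x y -> edge_label f [set x; y] \in [:: 1; -1].
Proof.
move=> xy; rewrite /edge_label insubT.
  by apply/existsP; exists x; apply/existsP; exists y; rewrite xy eqxx.
by move=> He /=; have := valP (f (Sub _ He)); rewrite !inE orbC.
Qed.

(** * A pair of paths with distant sums in one ladder *)

Section Ladder.

Variables (T : eqType) (e : rel T) (g : T -> T -> int).
Variables (c : bool -> nat -> T) (n : nat) (pos : T -> nat) (a : pred T).

Hypothesis c_rail : forall r j, (j.+1 < n)%N -> e (c r j) (c r j.+1).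
Hypothesis c_rung : forall r j, (j < n)%N -> e (c r j) (c (~~ r) j).
Hypothesis g_rung : forall r j, g (c r j) (c (~~ r) j) = g (c false j) (c true j).
Hypothesis g_sign : forall j, (j < n)%N -> g (c false j) (c true j) \in [:: 1; -1].
Hypothesis c_neq : forall r j, (j < n)%N -> c r j != c (~~ r) j.
Hypothesis pos_c : forall r j, (j < n)%N -> pos (c r j) = j.
Hypothesis a_c : forall r j, (j < n)%N -> a (c r j).

Let x0 := c false 0%N.

(** The bound on [pos] keeps column [t.+1] free for the next extension; [a] confines the path to its
    ladder, so that paths in different ladders are disjoint. *)
Definition ladder_path t r s :=
  [&& path e x0 s, uniq (x0 :: s), last x0 s == c r t
    & all [pred x | a x & (pos x <= t)%N] (x0 :: s)].

Lemma ladder_path_rail t r s : (t.+1 < n)%N -> ladder_path t r s ->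
  [&& ladder_path t.+1 r (rcons s (c r t.+1)),
      ladder_path t.+1 (~~ r) (rcons (rcons s (c r t.+1)) (c (~~ r) t.+1))
    & last x0 s == c r t].
Proof.
move=> tn /and4P[xs Us /eqP ls As].
have new r' : c r' t.+1 \notin x0 :: s.
  by apply/negP => /(allP As) /=; rewrite pos_c // ltnn andbF.
have As' : all [pred x | a x & (pos x <= t.+1)%N] (x0 :: s).
  by apply: sub_all As => x /= /andP[-> /leqW].
rewrite /ladder_path -!rcons_cons !rcons_path !last_rcons !rcons_uniq !all_rcons.
rewrite !mem_rcons !(in_cons (c r t.+1)) ls xs Us As' !eqxx c_rail // c_rung // !new /=.
by rewrite inE negb_or new eq_sym c_neq //= !a_c // !pos_c // leqnn.
Qed.

Lemma ladder_pairs t : (t < n)%N ->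
  exists A B : bool -> seq T,
    [/\ forall r, ladder_path t r (A r), forall r, ladder_path t r (B r) &
      path_sum g x0 (B false) + path_sum g x0 (B true) + t.*2%:R
        <= path_sum g x0 (A false) + path_sum g x0 (A true)].
Proof.
elim: t => [|t IH] tn.
  (* Rung 0 brings no gain: it serves to reach side [true], and both pairs start out equal. *)
  pose A r := if r then [:: c true 0%N] else [::].
  have HA r : ladder_path 0 r (A r).
    rewrite /ladder_path /A /x0; case: r => /=; rewrite ?inE !eqxx !a_c // !pos_c //=.
    by rewrite (c_rung false) //= andbT (c_neq false).
  by exists A, A; split=> //; rewrite addr0.
have [A [B [HA HB AB]]] := IH (ltnW tn).
(* Crossing exchanges the two members, so the new pair is again indexed by the side of its ends. *)
pose stay (A : bool -> seq T) r := rcons (A r) (c r t.+1).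
pose cross (A : bool -> seq T) r := rcons (rcons (A (~~ r)) (c (~~ r) t.+1)) (c r t.+1).
have H C : (forall r, ladder_path t r (C r)) ->
  [/\ forall r, ladder_path t.+1 r (stay C r),
      forall r, ladder_path t.+1 r (cross C r) &
      forall r, last x0 (C r) = c r t].
  move=> HC; split=> // r.
  - by case/and3P: (ladder_path_rail t r _ tn (HC r)).
  - by case/and3P: (ladder_path_rail t (~~ r) _ tn (HC (~~ r))) => _; rewrite negbK.
  - by case/and3P: (ladder_path_rail t r _ tn (HC r)) => _ _ /eqP.
have [sA cA lA] := H A HA; have [sB cB lB] := H B HB.
have gr := g_rung true t.+1; rewrite /= in gr.
have := g_sign _ tn; rewrite !inE => /orP[]/eqP gs.
- exists (cross A), (stay B); split=> //.
  rewrite /cross /stay !path_sum_rcons !last_rcons !lA !lB /= gr gs.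
  by move: AB; lia.
- exists (stay A), (cross B); split=> //.
  rewrite /cross /stay !path_sum_rcons !last_rcons !lA !lB /= gr gs.
  by move: AB; lia.
Qed.

Lemma ladder_gap : (1 < n)%N ->
  exists P Q, [/\ ladder_path n.-1 true P, ladder_path n.-1 true Q &
    path_sum g x0 Q + (n - 2)%:R <= path_sum g x0 P].
Proof.
(* Rungs 1 to [n - 2] gain [2 * (n - 2)] in total, hence at least [n - 2] on one of the sides. The
   last column is kept for bringing both paths to the same endpoint. *)
move=> n1; have tn : (n - 2 < n)%N by lia.
have [A [B [HA HB AB]]] := ladder_pairs _ tn.
have t1n : ((n - 2).+1 < n)%N by lia.
have -> : n.-1 = (n - 2).+1 by lia.
have /and3P[_ A0 /eqP lA0] := ladder_path_rail _ _ _ t1n (HA false).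
have /and3P[A1 _ /eqP lA1] := ladder_path_rail _ _ _ t1n (HA true).
have /and3P[_ B0 /eqP lB0] := ladder_path_rail _ _ _ t1n (HB false).
have /and3P[B1 _ /eqP lB1] := ladder_path_rail _ _ _ t1n (HB true).
(* From side [false] both paths take the rail and then the last rung, from side [true] only the
   rail. Both receive the same edges, so the gap survives. *)
have [le0|lt0] := leP (path_sum g x0 (B false) + (n - 2)%:R) (path_sum g x0 (A false)).
- do 2 eexists; split; [exact: A0 | exact: B0 |].
  rewrite !path_sum_rcons !last_rcons lA0 lB0; move: le0; lia.
- do 2 eexists; split; [exact: A1 | exact: B1 |].
  rewrite !path_sum_rcons lA1 lB1; move: AB lt0; lia.
Qed.

End Ladder.

(** * Chaining the ladders *)

Section Snake.

Variables (T : eqType) (e : rel T) (g : T -> T -> int).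
Variables (vt : nat -> nat -> T) (row col : T -> nat) (a b : nat).

Hypothesis e_sym : symmetric e.
Hypothesis g_sym : forall x y, g x y = g y x.
Hypothesis e_row : forall i j, (i < a)%N -> (j.+1 < b)%N -> e (vt i j) (vt i j.+1).
Hypothesis e_col : forall i j, (i.+1 < a)%N -> (j < b)%N -> e (vt i j) (vt i.+1 j).
Hypothesis g_col : forall i j, (i.+1 < a)%N -> (j < b)%N ->
  g (vt i j) (vt i.+1 j) \in [:: 1; -1].
Hypothesis row_vt : forall i j, (i < a)%N -> (j < b)%N -> row (vt i j) = i.
Hypothesis col_vt : forall i j, (i < a)%N -> (j < b)%N -> col (vt i j) = j.

(** Ladders of odd index are traversed backwards. *)
Definition snake_col m j := if odd m then (b.-1 - j)%N else j.

Definition snake_path (R : pred nat) x y s :=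
  [&& path e x s, uniq (x :: s), last x s == y
    & all (fun z => R (row z)./2) (x :: s)].

Lemma snake_ladder m : (m.*2.+1 < a)%N -> (1 < b)%N ->
  let x := vt m.*2 (snake_col m 0) in
  let y := vt m.*2.+1 (snake_col m b.-1) in
  exists P Q, [/\ snake_path (pred1 m) x y P, snake_path (pred1 m) x y Q &
    path_sum g x Q + (b - 2)%:R <= path_sum g x P].
Proof.
move=> ma b1 x y.
pose c (r : bool) j := vt (m.*2 + r)%N (snake_col m j).
have colb j : (j < b)%N -> (snake_col m j < b)%N by rewrite /snake_col; case: odd; lia.
have colK j : (j < b)%N -> snake_col m (snake_col m j) = j.
  by rewrite /snake_col; case: odd; lia.
have ra (r : bool) : (m.*2 + r < a)%N by case: r; lia.
(* On columns below [b], [snake_col m] is an involution, so applying it to [col x] recovers the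
   position along the traversal. *)
have [|||||||P [Q [HP HQ PQ]]] := @ladder_gap T e g c b (fun x => snake_col m (col x))
    (fun x => (row x)./2 == m) _ _ _ _ _ _ _ b1.
- move=> r j jb; rewrite /c /snake_col; case: odd; last exact: e_row.
  by rewrite e_sym; have -> : (b.-1 - j = (b.-1 - j.+1).+1)%N by [lia]; apply: e_row => //; lia.
- move=> r j jb; rewrite /c; case: r => /=; rewrite addn0 addn1 ?[e (vt _.+1 _) _]e_sym;
    by apply: e_col; rewrite ?colb.
- by move=> [] j //; rewrite g_sym.
- by move=> j jb; rewrite /c addn0 addn1; apply: g_col; rewrite ?colb.
- move=> r j jb; apply/eqP => /(congr1 row); rewrite /c !row_vt ?colb //.
  by case: r => /=; lia.
- by move=> r j jb; rewrite /c col_vt ?colb // colK.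
- by move=> r j jb; rewrite /c row_vt ?colb //; case: r => /=; lia.
move: HP HQ PQ; rewrite /ladder_path /c addn0 addn1 => HP HQ PQ.
have sub s : all [pred x | (row x)./2 == m & (snake_col m (col x) <= b.-1)%N] s ->
    all (fun x => (row x)./2 == m) s.
  by apply: sub_all => z /= /andP[].
exists P, Q; split=> //.
  by case/and4P: HP => *; apply/and4P; split=> //; apply: sub.
by case/and4P: HQ => *; apply/and4P; split=> //; apply: sub.
Qed.

Lemma snake_gap m : (m.*2.+1 < a)%N -> (1 < b)%N ->
  let x := vt 0 0 in let y := vt m.*2.+1 (snake_col m b.-1) in
  exists P Q, [/\ snake_path (leq^~ m) x y P, snake_path (leq^~ m) x y Q &
    path_sum g x Q + (m.+1 * (b - 2))%:R <= path_sum g x P].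
Proof.
move=> ma b1; elim: m ma => [|m IH] ma.
  have weaken x y s : snake_path (pred1 0) x y s -> snake_path (leq^~ 0) x y s.
    case/and4P=> ? ? ? als; apply/and4P; split=> //.
    by apply: sub_all als => z /eqP->.
  have [P [Q [HP HQ PQ]]] := snake_ladder 0 ma b1.
  by exists P, Q; rewrite mul1n; split=> //; apply: weaken.
have [|P [Q [HP HQ PQ]]] := IH; first by lia.
have [P' [Q' [HP' HQ' PQ']]] := snake_ladder m.+1 ma b1.
set y := vt (m.+1).*2 _ in PQ' HP' HQ'.
set z := vt m.*2.+1 _ in HP HQ.
(* The change of parity makes ladder [m] end in the column where the next one starts. Both paths use
   this connecting edge, so the gaps add up. *)
have zy : e z y.
  have -> : y = vt m.*2.+2 (snake_col m b.-1).
    by rewrite /y /snake_col doubleS /=; case: odd; rewrite /= ?subnn ?subn0.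
  by apply: e_col; rewrite /snake_col; [|case: odd]; lia.
have glue x w s s' : snake_path (leq^~ m) x z s -> snake_path (pred1 m.+1) y w s' ->
    snake_path (leq^~ m.+1) x w (s ++ y :: s') /\
    path_sum g x (s ++ y :: s') = path_sum g x s + (g z y + path_sum g y s').
  case/and4P=> ps us /eqP ls als /and4P[ps' us' ls' als'].
  rewrite path_sum_cat /= ls; split=> //.
  apply/and4P; split.
  - by rewrite cat_path /= ps ls zy.
  - rewrite -cat_cons cat_uniq; apply/and3P; split=> //.
    apply/hasPn => x' xs'; apply/negP => /(allP als); have /eqP := allP als' _ xs'.
    by move->; rewrite ltnn.
  - by rewrite last_cat.
  - rewrite -cat_cons all_cat; apply/andP; split.
      by apply: sub_all als => x'; apply: leqW.
    by apply: sub_all als' => x' /eqP->.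
have [GP sP] := glue _ _ _ _ HP HP'; have [GQ sQ] := glue _ _ _ _ HQ HQ'.
exists (P ++ y :: P'), (Q ++ y :: Q'); split=> //.
by rewrite sP sQ; move: PQ PQ'; lia.
Qed.

(** Two integers at distance at least [N] cannot both have absolute value below [N / 2]. *)
Lemma snake_path_sum :
  (1 < a)%N -> (1 < b)%N -> exists s, [/\ path e (vt 0 0) s, uniq (vt 0 0 :: s) &
    (a./2 * (b - 2) <= 2 * `|path_sum g (vt 0 0) s|)%N].
Proof.
(* Ladders are numbered from 0; for odd [a] the last line is left out. *)
move=> a1 b1; have ma : ((a./2.-1).*2.+1 < a)%N by lia.
have [P [Q [/and4P[pP uP _ _] /and4P[pQ uQ _ _]]]] := snake_gap _ ma b1.
have -> : a./2.-1.+1 = a./2 by lia.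
move: (a./2 * _)%N => N PQ.
have [le|lt] := leqP N (2 * `|path_sum g (vt 0 0) P|); first by exists P.
by exists Q; split=> //; lia.
Qed.

End Snake.

(** * The grid and the final count *)

Lemma grid_discrepancy (k l : nat) : (1 < k)%N -> (1 < l)%N ->
  let D := discrepancy (paths (cart_prod (path_graph k) (path_graph l))) in
  (k./2 * (l - 2) <= 2 * D)%N /\ (l./2 * (k - 2) <= 2 * D)%N.
Proof.
case: k l => [//|k] [//|l] k1 l1.
set G := cart_prod _ _ => D.
have [f Hf] := discrepancy_paths_ge G.
pose g (x y : G) := edge_label f [set x; y].
have gC x y : g x y = g y x by rewrite /g setUC.
(* [inord] sends indices out of range to 0; the range hypotheses keep such values from mattering. *)
pose w i j : G := (inord i : 'I_k.+1, inord j : 'I_l.+1).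
have adj1 i j : (i.+1 < k.+1)%N -> (j < l.+1)%N -> adj (w i j) (w i.+1 j).
  by move=> hi hj; rewrite /= /cart_adj /= /path_adj /= eqxx !inordK ?eqxx ?andbT ?orbT //; lia.
have adj2 i j : (i < k.+1)%N -> (j.+1 < l.+1)%N -> adj (w i j) (w i j.+1).
  by move=> hi hj; rewrite /= /cart_adj /= /path_adj /= eqxx !inordK ?eqxx ?andbT ?orbT //; lia.
have sgn x y : adj x y -> g x y \in [:: 1; -1] by apply: edge_label_sign.
(* The second bound comes from the same snake in the transposed grid. *)
split.
- have [||||||s [ps us]] := @snake_path_sum G (@adj G) g w
    (fun x => val x.1) (fun x => val x.2) k.+1 l.+1 _ gC _ _ _ _ _ k1 l1.
  + exact: adj_sym.
  + by move=> i j; apply: adj2.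
  + by move=> i j; apply: adj1.
  + by move=> i j hi hj; apply/sgn/adj1.
  + by move=> i j hi hj /=; rewrite inordK.
  + by move=> i j hi hj /=; rewrite inordK.
  + by move=> /leq_trans; apply; rewrite leq_mul2l Hf ?orbT.
- have [||||||s [ps us]] := @snake_path_sum G (@adj G) g (fun i j => w j i)
    (fun x => val x.2) (fun x => val x.1) l.+1 k.+1 _ gC _ _ _ _ _ l1 k1.
  + exact: adj_sym.
  + by move=> i j hi hj; apply: adj1.
  + by move=> i j hi hj; apply: adj2.
  + by move=> i j hi hj; apply/sgn/adj2.
  + by move=> i j hi hj /=; rewrite inordK.
  + by move=> i j hi hj /=; rewrite inordK.
  + by move=> /leq_trans; apply; rewrite leq_mul2l Hf ?orbT.
Qed.

Theorem proposition1p6 (k l : nat) (hk : (0 < k)%N) (hl : (0 < l)%N) :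
  (k * l)%:R / 8 - (maxn k l)%:R / 8 - (minn k l)%:R
    < (discrepancy (paths (cart_prod (path_graph k) (path_graph l))))%:R :> rat.
Proof.
set D := discrepancy _.
(* The claim times 8, with the subtractions moved across to stay in [nat]. *)
have key : (k * l < maxn k l + 8 * minn k l + 8 * D)%N.
  (* If a side is 1, then [k * l] equals the maximum and the minimum is positive. *)
  have [k1|k1] := leqP k 1; first by have -> : k = 1%N by [lia]; lia.
  have [l1|l1] := leqP l 1; first by have -> : l = 1%N by [lia]; lia.
  have [/= H1 H2] := grid_discrepancy k l k1 l1; rewrite -/D in H1 H2.
  (* The ladders run along the longer side. Since [k - 1 <= 2 * k./2], odd [k] is covered too, and
     expanding gives [k * l + 2 <= l + 2 * k + 4 * D]. *)
  have [kl|lk] := leqP k l.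
    have : ((k - 1) * (l - 2) <= 4 * D)%N.
      by apply: (@leq_trans (2 * k./2 * (l - 2))); [rewrite leq_mul2r; lia | lia].
    by nia.
  have : ((l - 1) * (k - 2) <= 4 * D)%N.
    by apply: (@leq_trans (2 * l./2 * (k - 2))); [rewrite leq_mul2r; lia | lia].
  by nia.
by move: key; rewrite -(ltr_nat rat) !natrD !natrM; lra.
Qed.
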